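(* Suppose $f\in\mathrm{QSym}$ and $f=\sum_\alpha c_\alpha\psi_\alpha$. Then for every composition $\alpha$, $c_\alpha=\mathrm{MinOne}^{\otimes l(\alpha)}(\Delta_\alpha f)$.
   Context: $\mathrm{QSym}$ is the algebra of quasisymmetric functions over $\mathbb{C}$, with monomial basis $M_\alpha=\sum_{i_1<\dots<i_k}x_{i_1}^{\alpha_1}\cdots x_{i_k}^{\alpha_k}$ and fundamental basis $L_\alpha=\sum_{\beta\text{ refines }\alpha}M_\beta$. For a composition $\alpha=(\alpha_1,\dots,\alpha_l)$ (with $l(\alpha)=l$) let $\pi(\alpha)=\prod_{i=1}^{l}(\alpha_1+\cdots+\alpha_i)$; if $\alpha$ refines $\beta$, let $\alpha^{(i)}$ be the parts of $\alpha$ summing to $\beta_i$ and $\pi(\alpha,\beta)=\prod_i\pi(\alpha^{(i)})$. Define $\psi_\alpha=\sum_{\beta\text{ coarsens }\alpha}\frac{1}{\pi(\alpha,\beta)}M_\beta$ (these form a basis). $\mathrm{MinOne}$ is the linear functional on $\mathrm{QSym}$ with $\mathrm{MinOne}(L_\alpha)=(-1)^k$ if $\alpha=(1^k,n-k)$ for some $0\le k<n$ ($n=|\alpha|$) and $0$ otherwise. The coproduct on $\mathrm{QSym}$ is $\Delta(M_\alpha)=\sum_{\beta\cdot\gamma=\alpha}M_\beta\otimes M_\gamma$ (deconcatenation, empty compositions allowed, $M_\varnothing=1$). For a composition $\alpha$ of length $l$, $\Delta_\alpha\colon\mathrm{QSym}\to\mathrm{QSym}^{\otimes l}$ is the $(l-1)$-fold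 iterated coproduct followed by projection onto $\mathrm{QSym}_{\alpha_1}\otimes\cdots\otimes\mathrm{QSym}_{\alpha_l}$ (where $\mathrm{QSym}_d$ is the degree-$d$ component). *)

(* Defs.v *)
From HB Require Import structures.
From mathcomp Require Import all_boot all_order all_algebra.
From mathcomp Require Import generic_quotient ring_quotient.
From mathcomp Require Import finmap freeg complex.
From mathcomp Require Import all_classical reals.

Set Implicit Arguments.
Unset Strict Implicit.
Unset Printing Implicit Defensive.

Import GRing.Theory.

Local Open Scope classical_set_scope.
Local Open Scope ring_scope.

Section FreeLift.
Variables (K : fieldType) (I : choiceType) (T : lmodType K) (g : I -> T).

HB.instance Definition _ :=
  GRing.isZmodMorphism.Build {freeg I / K} T (fglift g) (lift_is_additive g).

Fact fglift_scalable : scalable (fglift g).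
Proof.
move=> a x; rewrite -[in RHS](freeg_sumE x).
have -> : a *: x = \sum_(z <- dom x) << a * coeff z x *g z >> by [].
rewrite !raddf_sum /=; apply: eq_bigr => i _.
by rewrite !liftU scalerA.
Qed.

HB.instance Definition _ :=
  GRing.isScalable.Build K {freeg I / K} T *:%R (fglift g) fglift_scalable.

End FreeLift.

Section Tensor.
Variables (K : fieldType) (U W : lmodType K).
Local Notation free := {freeg (U * W) / K}.

(* U (x) W is the free module on U * W modulo the bilinearity relations *)
Inductive tensor_null : free -> Prop :=
| TensorNull0 : tensor_null 0
| TensorNullP a x y :
    tensor_null x -> tensor_null y -> tensor_null (a *: x + y)
| TensorNullL a u v w :
    tensor_null (<< (a *: u + v, w) >> - (a *: << (u, w) >> + << (v, w) >>))
| TensorNullR a u w z :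
    tensor_null (<< (u, a *: w + z) >> - (a *: << (u, w) >> + << (u, z) >>)).

Definition tensor_nullb : {pred free} := fun x => `[< tensor_null x >].

Fact tensor_nullb_closed : submod_closed tensor_nullb.
Proof.
split; first exact/asboolP/TensorNull0.
by move=> a x y /asboolP ? /asboolP ?; exact/asboolP/TensorNullP.
Qed.

HB.instance Definition _ :=
  GRing.isSubmodClosed.Build K free tensor_nullb tensor_nullb_closed.

Definition tensor : Type := Quotient.quot tensor_nullb.

HB.instance Definition _ := GRing.Zmodule.on tensor.

Definition to_tensor (x : free) : tensor := \pi_(Quotient.quot tensor_nullb)%qT x.

Fact to_tensor_additive : zmod_morphism to_tensor.
Proof. by move=> x y; rewrite /to_tensor; exact: raddfB. Qed.

Lemma to_tensorP x y :
  reflect (to_tensor x = to_tensor y) (x - y \in tensor_nullb).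
Proof. by rewrite Quotient.idealrBE; exact: eqP. Qed.

Definition tensor_repr (t : tensor) : free := repr t.

Lemma tensor_reprK t : to_tensor (tensor_repr t) = t.
Proof. exact: reprK. Qed.

HB.instance Definition _ :=
  GRing.isZmodMorphism.Build free tensor to_tensor to_tensor_additive.

Definition tensor_scale a (t : tensor) : tensor := to_tensor (a *: tensor_repr t).

Lemma tensor_scaleE a x : tensor_scale a (to_tensor x) = to_tensor (a *: x).
Proof.
apply/to_tensorP; rewrite -scalerBr rpredZ//; apply/to_tensorP.
exact: tensor_reprK.
Qed.

Fact tensor_scaleA a b t : tensor_scale a (tensor_scale b t) = tensor_scale (a * b) t.
Proof. by rewrite -[t]tensor_reprK !tensor_scaleE scalerA. Qed.

Fact tensor_scale1 : left_id 1 tensor_scale.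
Proof. by move=> t; rewrite -[t]tensor_reprK tensor_scaleE scale1r. Qed.

Fact tensor_scaleDr : right_distributive tensor_scale +%R.
Proof.
move=> a s t; rewrite -[s]tensor_reprK -[t]tensor_reprK -raddfD.
by rewrite !tensor_scaleE -raddfD scalerDr.
Qed.

Fact tensor_scaleDl t : {morph tensor_scale^~ t : a b / a + b}.
Proof.
by move=> a b /=; rewrite -[t]tensor_reprK !tensor_scaleE -raddfD scalerDl.
Qed.

HB.instance Definition _ := GRing.Zmodule_isLmodule.Build K tensor
  tensor_scaleA tensor_scale1 tensor_scaleDr tensor_scaleDl.

Fact to_tensor_scalable : scalable to_tensor.
Proof. by move=> a x; rewrite -tensor_scaleE. Qed.

HB.instance Definition _ :=
  GRing.isScalable.Build K free tensor *:%R to_tensor to_tensor_scalable.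

Definition tens (u : U) (w : W) : tensor := to_tensor << (u, w) >>.

Fact tens_linear_l w : linear (tens^~ w).
Proof.
move=> a u v; rewrite /tens -linearP; apply/to_tensorP/asboolP.
exact: TensorNullL.
Qed.

Fact tens_linear_r u : linear (tens u).
Proof.
move=> a w z; rewrite /tens -linearP; apply/to_tensorP/asboolP.
exact: TensorNullR.
Qed.

Section Lift.
Variables (T : lmodType K) (b : U -> W -> T).
Hypotheses (bl : forall w, linear (b^~ w)) (br : forall u, linear (b u)).

Definition tensor_lift (t : tensor) : T :=
  fglift (fun p => b p.1 p.2) (tensor_repr t).

Lemma tensor_liftE x : tensor_lift (to_tensor x) = fglift (fun p => b p.1 p.2) x.
Proof.
have ker y : tensor_null y -> fglift (fun p => b p.1 p.2) y = 0.
  elim=> [|a {}y z _ y0 _ z0|a u v w|a u w z]; first by rewrite linear0.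
  - by rewrite linearP /= y0 z0 scaler0 addr0.
  - by rewrite linearB linearP /= !liftU !scale1r /= bl subrr.
  - by rewrite linearB linearP /= !liftU !scale1r /= br subrr.
apply/eqP; rewrite -subr_eq0 -linearB; apply/eqP/ker/asboolP.
by apply/to_tensorP; exact: tensor_reprK.
Qed.

Fact tensor_lift_linear : linear tensor_lift.
Proof.
move=> a s t; rewrite -[s]tensor_reprK -[t]tensor_reprK -linearP.
by rewrite !tensor_liftE linearP.
Qed.

Lemma tensor_lift_tens u w : tensor_lift (tens u w) = b u w.
Proof. by rewrite tensor_liftE liftU scale1r. Qed.

Definition tensor_linmap : {linear tensor -> T} :=
  HB.pack tensor_lift
    (GRing.isLinear.Build K tensor T *:%R tensor_lift tensor_lift_linear).

End Lift.
End Tensor.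

Section TensorMap.
Variables (K : fieldType) (U W U' W' : lmodType K).
Variables (g : {linear U -> U'}) (h : {linear W -> W'}).

Fact tensor_map_l w : linear (fun u => tens (g u) (h w)).
Proof. by move=> a u v; rewrite linearP tens_linear_l. Qed.

Fact tensor_map_r u : linear (fun w => tens (g u) (h w)).
Proof. by move=> a w z; rewrite linearP tens_linear_r. Qed.

Definition tensor_map : {linear tensor U W -> tensor U' W'} :=
  tensor_linmap tensor_map_l tensor_map_r.

Lemma tensor_map_tens u w : tensor_map (tens u w) = tens (g u) (h w).
Proof. exact: (tensor_lift_tens tensor_map_l tensor_map_r). Qed.

End TensorMap.

Section TensorFunctional.
Variables (K : fieldType) (U W : lmodType K).
Variables (g : {linear U -> K^o}) (h : {linear W -> K^o}).

Fact tensor_fun_l w : linear (fun u => g u * h w : K^o).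
Proof. by move=> a u v; rewrite linearP mulrDl scalerAl. Qed.

Fact tensor_fun_r u : linear (fun w => g u * h w : K^o).
Proof. by move=> a w z; rewrite linearP mulrDr scalerAr. Qed.

(* g (x) h followed by the identification of K (x) K with K *)
Definition tensor_fun : {linear tensor U W -> K^o} :=
  tensor_linmap tensor_fun_l tensor_fun_r.

Lemma tensor_fun_tens u w : tensor_fun (tens u w) = g u * h w.
Proof. exact: (tensor_lift_tens tensor_fun_l tensor_fun_r). Qed.

End TensorFunctional.

Section TensorPower.
Variables (K : fieldType) (V : lmodType K).

(* tpow 0 = K, tpow 1 = V and tpow l.+1 = V (x) tpow l for l > 0 *)
Fixpoint tpow (l : nat) : lmodType K :=
  if l is l'.+1 then if l' is _.+1 then tensor V (tpow l') else V else K^o.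

Fixpoint tpow_fun (phi : {linear V -> K^o}) (l : nat) :
    {linear tpow l -> K^o} :=
  match l return {linear tpow l -> K^o} with
  | 0 => idfun
  | l'.+1 =>
    match l' return {linear tpow l' -> K^o} -> {linear tpow l'.+1 -> K^o} with
    | 0 => fun _ => phi
    | _.+1 => fun phi' => tensor_fun phi phi'
    end (tpow_fun phi l')
  end.

Fixpoint tpow_map (J : Type) (g : J -> {linear V -> V}) (s : seq J) :
    {linear tpow (size s) -> tpow (size s)} :=
  match s return {linear tpow (size s) -> tpow (size s)} with
  | [::] => idfun
  | d :: s' =>
    match s' return {linear tpow (size s') -> tpow (size s')} ->
                    {linear tpow (size s').+1 -> tpow (size s').+1} with
    | [::] => fun _ => g d
    | _ :: _ => fun h => tensor_map (g d) h
    end (tpow_map g s')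
  end.

(* the (l-1)-fold iterated coproduct; by convention, the counit for l = 0 *)
Fixpoint iter_coprod (Delta : {linear V -> tensor V V})
    (eps : {linear V -> K^o}) (l : nat) : {linear V -> tpow l} :=
  match l return {linear V -> tpow l} with
  | 0 => eps
  | l'.+1 =>
    match l' return {linear V -> tpow l'} -> {linear V -> tpow l'.+1} with
    | 0 => fun _ => idfun
    | _.+1 => fun D => tensor_map idfun D \o Delta
    end (iter_coprod Delta eps l')
  end.

End TensorPower.

Section Basis.
Variables (K : fieldType) (I : choiceType) (V : lmodType K) (b : I -> V).

(* fglift b c is the finite sum of the coeff i c *: b i *)
Definition is_basis := forall v, exists! c : {freeg I / K}, v = fglift b c.

Hypothesis hb : is_basis.

Definition coords (v : V) : {freeg I / K} := sval (cid (hb v)).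

Lemma coordsK v : fglift b (coords v) = v.
Proof. by rewrite /coords; case: cid => c /= [->]. Qed.

Lemma fgliftK c : coords (fglift b c) = c.
Proof. by rewrite /coords; case: cid => c' /= [_]; exact. Qed.

Section LinExt.
Variables (W : lmodType K) (g : I -> W).

Definition linext_fun (v : V) : W := fglift g (coords v).

Fact linext_linear : linear linext_fun.
Proof.
move=> a u v; rewrite /linext_fun -linearP; congr fglift.
by rewrite -[RHS]fgliftK linearP /= !coordsK.
Qed.

(* the linear map sending each b i to g i *)
Definition linext : {linear V -> W} :=
  HB.pack linext_fun (GRing.isLinear.Build K V W *:%R linext_fun linext_linear).

Lemma linextE i : linext (b i) = g i.
Proof.
have -> : b i = fglift b << i >> by rewrite liftU scale1r.
by rewrite /= /linext_fun fgliftK liftU scale1r.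
Qed.

End LinExt.
End Basis.

Record composition := Composition {
  parts :> seq nat;
  parts_gt0 : all (ltn 0) parts
}.

HB.instance Definition _ := [isSub for parts].
HB.instance Definition _ := [Choice of composition by <:].

(* each part of b is the sum of a block of consecutive parts of a *)
Definition refines (a b : seq nat) : Prop :=
  exists ss : seq (seq nat), flatten ss = a /\ map sumn ss = b.

(* the parts of a summing to the i-th part of b: those parts a_j such that
   b_0 + ... + b_(i-1) < a_0 + ... + a_j <= b_0 + ... + b_i *)
Definition block (a b : seq nat) (i : nat) : seq nat :=
  [seq nth 0 a j | j <- iota 0 (size a)
     & sumn (take i b) < sumn (take j.+1 a) <= sumn (take i.+1 b)]%N.

Definition pi_comp (a : seq nat) : nat :=
  (\prod_(i < size a) sumn (take i.+1 a))%N.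

Definition pi_refine (a b : seq nat) : nat :=
  (\prod_(i < size b) pi_comp (block a b i))%N.

(* monomials in the variables x_0, x_1, ..., given by their exponents *)
Definition monomial := {fsfun nat -> nat with 0%N}.

(* (a_1, ..., a_k) for the monomial x_{i_1}^{a_1} ... x_{i_k}^{a_k} with
   i_1 < ... < i_k and all a_j > 0 *)
Definition exponents (m : monomial) : seq nat :=
  [seq m i | i <- sort leq (finsupp m)].

Definition mdegree (m : monomial) : nat := sumn (exponents m).

Fact exponents_gt0 m : all (ltn 0) (exponents m).
Proof.
rewrite /exponents all_map; apply/allP => i; rewrite mem_sort mem_finsupp /= => mi0.
by rewrite lt0n.
Qed.

Definition exponent_comp (m : monomial) := Composition (exponents_gt0 m).

Lemma exponent_comp_onto (a : composition) : exists m, exponent_comp m = a.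
Proof.
pose m : monomial := [fsfun i in seq_fset tt (iota 0 (size a)) => nth 0%N a i].
have mE i : m i = nth 0%N a i.
  by rewrite fsfunE seq_fsetE mem_iota /= add0n; case: ltnP => // ?; rewrite nth_default.
have suppE : sort leq (finsupp m) = iota 0 (size a).
  apply: (sorted_eq leq_trans anti_leq).
  - exact/sort_sorted/leq_total.
  - exact: iota_sorted.
  apply: uniq_perm; [by rewrite sort_uniq fset_uniq|exact: iota_uniq|move=> i].
  rewrite mem_sort mem_finsupp mE mem_iota /= add0n.
  case: ltnP => [ilt|ige]; last by rewrite nth_default// eqxx.
  by rewrite -lt0n; have /all_nthP := parts_gt0 a; exact.
exists m; apply/val_inj; rewrite /= /exponents suppE.
apply: (@eq_from_nth _ 0%N); rewrite size_map size_iota// => i ilt.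
by rewrite (nth_map 0%N) ?size_iota// nth_iota// add0n mE.
Qed.

Section QSym.
Variable K : fieldType.

(* formal power series of bounded degree in which monomials with the same
   exponents along increasing indices have the same coefficient *)
Definition quasisymmetric : {pred monomial -> K^o} := fun f => `[<
  (exists d, forall m, (d < mdegree m)%N -> f m = 0) /\
  (forall m m', exponents m = exponents m' -> f m = f m') >].

Fact quasisymmetric_closed : submod_closed quasisymmetric.
Proof.
split; first by apply/asboolP; split=> //; exists 0%N.
move=> a f g /asboolP[[d fd] fE] /asboolP[[e ge] gE]; apply/asboolP; split.
  exists (maxn d e) => m; rewrite gtn_max => /andP[dm em].
  by rewrite /GRing.add /= /GRing.scale /= fd// ge// scaler0 addr0.
by move=> m m' mm'; rewrite /GRing.add /= /GRing.scale /= (fE _ _ mm') (gE _ _ mm').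
Qed.

HB.instance Definition _ := GRing.isSubmodClosed.Build K (monomial -> K^o)
  quasisymmetric quasisymmetric_closed.

Record QSym := MkQSym {
  qseries :> monomial -> K^o;
  qseriesP : qseries \in quasisymmetric
}.

HB.instance Definition _ := [isSub for qseries].
HB.instance Definition _ := [Choice of QSym by <:].
HB.instance Definition _ := [SubChoice_isSubLmodule of QSym by <:].

Fact monomial_qsym_subproof (a : composition) :
  (fun m => (exponents m == a)%:R : K^o) \in quasisymmetric.
Proof.
apply/asboolP; split; last by move=> m m' ->.
exists (sumn a) => m; case: eqP => // ma.
by rewrite /mdegree ma ltnn.
Qed.

(* M_a is the sum of all the monomials x_{i_1}^{a_1} ... x_{i_k}^{a_k} with
   i_1 < ... < i_k, each of which has coefficient 1 *)
Definition M (a : composition) : QSym := MkQSym (monomial_qsym_subproof a).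

(* A sum over a classical set is 0 when its support is infinite; here all the
   index sets are finite: see finite_refining, finite_coarsening and
   finite_deconcat below. *)
Definition L (a : composition) : QSym :=
  \sum_(b \in [set b : composition | refines b a]) M b.

Definition psi (a : composition) : QSym :=
  \sum_(b \in [set b : composition | refines a b]) (pi_refine a b)%:R^-1 *: M b.

End QSym.

Lemma refines_refl a : refines a a.
Proof.
exists [seq [:: x] | x <- a]; split; first exact: flatten_seq1.
by rewrite -map_comp -[RHS]map_id; apply: eq_map => x /=; rewrite addn0.
Qed.

Lemma refines_sumn a b : refines a b -> sumn a = sumn b.
Proof. by case=> ss [<- <-]; rewrite sumn_flatten. Qed.

Lemma refines_size a (b : composition) :
  refines a b -> (size b <= size a)%N /\ (size a = size b -> a = b).
Proof.
case: b => b /= b0 [ss [<- bE]]; elim: ss b b0 bE => [|s ss IHss] _ /[swap] <- //=.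
move=> /andP[s0 /IHss /(_ erefl)[sz eqs]].
rewrite size_map in sz eqs *; rewrite size_cat.
have {}s0 : (0 < size s)%N by case: s s0.
split=> [|sE]; first by rewrite -add1n leq_add.
have : size s = 1%N.
  by apply/eqP; rewrite eqn_leq s0 andbT -(leq_add2r (size ss)) add1n -sE leq_add2l.
case: s sE {s0} => [|x []]//= [sE] _; rewrite addn0; congr cons; exact: eqs.
Qed.

Lemma size_composition (a : composition) : (size a <= sumn a)%N.
Proof.
case: a => a /=; elim: a => //= x a IHa /andP[x0 /IHa].
by rewrite -add1n; exact: leq_add.
Qed.

Lemma finite_compositions n : finite_set [set a : composition | sumn a = n].
Proof.
pose F := fix F k := if k is k'.+1 then
  [::] :: [seq x :: s | x <- iota 0 n.+1, s <- F k'] else [:: [::]].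
have FP k (s : seq nat) : (size s <= k)%N -> all (leq^~ n) s -> s \in F k.
  elim: k s => [|k IHk] [|x s]// sk /andP[xn sn].
  rewrite in_cons; apply/orP; right.
  by apply/allpairsP; exists (x, s); rewrite mem_iota add0n ltnS /= xn; split=> //; exact: IHk.
apply: (@sub_finite_set _ _ [set` pmap insub (F n) : seq composition]); last exact: finite_seq.
move=> a /= an; rewrite mem_pmap_sub /=; apply: FP.
  by rewrite -an size_composition.
rewrite -an; apply/allP => x /(nthP 0%N)[i ilt <-].
by rewrite -{2}(cat_take_drop i a) (drop_nth 0%N)// sumn_cat /= addnCA leq_addr.
Qed.

Lemma finite_refining (a : composition) :
  finite_set [set b : composition | refines b a].
Proof.
apply: sub_finite_set (finite_compositions (sumn a)) => b /=.
exact: refines_sumn.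
Qed.

Lemma finite_coarsening (a : composition) :
  finite_set [set b : composition | refines a b].
Proof.
apply: sub_finite_set (finite_compositions (sumn a)) => b /= ab.
by rewrite (refines_sumn ab).
Qed.

Section Bases.
Variable K : fieldType.
Local Notation QSym := (QSym K).
Local Notation M := (@M K).
Local Notation L := (@L K).

Lemma QSymP (f g : QSym) : f =1 g -> f = g.
Proof. by move=> fg; apply/val_inj/funext. Qed.

Lemma QSymD (f g : QSym) m : (f + g) m = f m + g m.
Proof. by []. Qed.

Lemma QSymZ k (f : QSym) m : (k *: f) m = k * f m.
Proof. by []. Qed.

Lemma QSym_sum (I : Type) (r : seq I) (F : I -> QSym) m :
  (\sum_(i <- r) F i) m = \sum_(i <- r) F i m.
Proof. by elim: r => [|i r IHr]; rewrite ?big_nil// !big_cons QSymD IHr. Qed.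

Lemma ME a m : M a m = (exponent_comp m == a)%:R.
Proof. by rewrite -val_eqE. Qed.

Lemma fglift_ME (c : {freeg composition / K}) m :
  fglift M c m = coeff (exponent_comp m) c.
Proof.
rewrite -[in LHS](freeg_sumE c) linear_sum QSym_sum.
rewrite -[in RHS](freeg_sumE c) raddf_sum /=.
by apply: eq_bigr => a _; rewrite liftU QSymZ ME coeffU eq_sym.
Qed.

Lemma M_basis : is_basis M.
Proof.
move=> f; have /asboolP[[d fd] fE] := qseriesP f.
pose r := fset_set (\bigcup_(n in `I_d.+1) [set a : composition | sumn a = n]).
have rP a : (a \in r) = (sumn a <= d)%N.
  rewrite in_fset_set; last by apply: bigcup_finite => // n _; exact: finite_compositions.
  apply/idP/idP; first by rewrite inE => -[n /= nd ->].
  by move=> ad; rewrite inE; exists (sumn a).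
have [mon monK] := choice exponent_comp_onto.
pose c : {freeg composition / K} := \sum_(a <- r) << f (mon a) *g a >>.
have cE m : coeff (exponent_comp m) c = f m.
  rewrite /c raddf_sum /=; under eq_bigr do rewrite coeffU.
  have [mr|mr] := boolP (exponent_comp m \in r).
    rewrite (big_fsetD1 (exponent_comp m))//= eqxx mulr1 big1_fset ?addr0.
      by apply: fE; have /(congr1 val) /= := monK (exponent_comp m).
    by move=> a; rewrite !inE => /andP[/negbTE-> _] _; rewrite mulr0.
  rewrite big1_fset => [|a ar _].
    by rewrite fd// -[mdegree m]/(sumn (exponent_comp m)) ltnNge -rP.
  by case: eqP mr => [<-|_ _]; rewrite ?ar ?mulr0.
exists c; split=> [|c' fc']; first by apply: QSymP => m; rewrite fglift_ME cE.
apply/eqP/freeg_eqP => a; have [m <-] := exponent_comp_onto a.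
by rewrite cE fc' fglift_ME.
Qed.

Lemma LE a m : L a m = `[< refines (exponents m) a >]%:R.
Proof.
rewrite /L fsbig_finite ?QSym_sum; last exact: finite_refining.
under eq_bigr do rewrite ME.
set r := fset_set _.
have rP b : (b \in r) = `[< refines b a >].
  by rewrite in_fset_set; [exact: asbool_equiv_eq|exact: finite_refining].
have [mr|mr] := boolP (exponent_comp m \in r).
  rewrite (big_fsetD1 (exponent_comp m))//= eqxx big1_fset ?addr0.
    by move: mr; rewrite rP /= => ->.
  by move=> b; rewrite !inE eq_sym => /andP[/negbTE-> _] _.
rewrite big1_fset => [|b br _]; first by move: mr; rewrite rP /= => /negbTE->.
by case: eqP mr => // ->; rewrite br.
Qed.

Lemma M_spanL a : exists c, fglift L c = M a.
Proof.
have [n] := ubnP (sumn a - size a)%N; elim: n a => // n IHn a.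
rewrite ltnS => an; set A := [set b : composition | refines b a].
have finA : finite_set A := finite_refining a.
have LE : L a = M a + \sum_(b <- fset_set (A `\ a)) M b.
  rewrite /L (fsbigD1 a)//=; last exact: refines_refl.
  by rewrite fsbig_finite//; exact: finite_setD.
have spanA b : exists c, b \in fset_set (A `\ a) -> fglift L c = M b.
  have [bA|] := boolP (b \in fset_set (A `\ a)); last by exists 0.
  move: bA; rewrite in_fset_set ?inE; last exact: finite_setD.
  move=> [/= ba bneq]; have [sz eqs] := refines_size ba.
  have szlt : (size a < size b)%N.
    by rewrite ltn_neqAle sz andbT; apply/eqP => /esym /eqs /val_inj.
  have /IHn[c cE] : (sumn b - size b < n)%N.
    apply: leq_trans an; rewrite (refines_sumn ba); apply: (ltn_sub2l _ szlt).
    by rewrite -(refines_sumn ba) (leq_trans szlt)// size_composition.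
  by exists c.
have [c cE] := choice spanA.
exists (<< a >> - \sum_(b <- fset_set (A `\ a)) c b).
rewrite linearB linear_sum /= liftU scale1r LE.
by rewrite [X in _ - X](eq_big_seq _ cE) addrK.
Qed.

Lemma fgliftL_inj (c : {freeg composition / K}) : fglift L c = 0 -> c = 0.
Proof.
move=> c0; apply/eqP; rewrite -dom_eq0; case domE: (dom c) => [//|a0 s].
have a0c : a0 \in dom c by rewrite domE mem_head.
have /ex_minnP[n /hasP[a ac /eqP an] nmin] : exists n, has (fun a : composition => size a == n) (dom c).
  by exists (size a0); apply/hasP; exists a0.
have [m ma] := exponent_comp_onto a.
have : fglift L c m = 0 by rewrite c0.
rewrite -[c in fglift _ c]freeg_sumE linear_sum QSym_sum /=.
under eq_bigr do rewrite liftU QSymZ LE.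
have -> : exponents m = a by rewrite -ma.
rewrite (bigD1_seq a) ?uniq_dom//= asboolT ?mulr1; last exact: refines_refl.
rewrite big_seq_cond big1 ?addr0 => [/eqP|b /andP[bc ba]].
  by move: ac; rewrite mem_dom => /negbTE->.
case: asboolP; rewrite ?mulr0// => /refines_size[sz eqs].
have /nmin nb : has (fun a : composition => size a == size b) (dom c).
  by apply/hasP; exists b.
have /eqs/val_inj : size a = size b by apply/eqP; rewrite eqn_leq sz andbT an.
by move=> ab; rewrite ab eqxx in ba.
Qed.

Lemma L_basis : is_basis L.
Proof.
move=> f; have [c [fc _]] := M_basis f; have [d dE] := choice M_spanL.
exists (\sum_(a <- dom c) coeff a c *: d a).
split=> [|c' fc'].
  rewrite fc -[in LHS](freeg_sumE c) !linear_sum; apply: eq_bigr => a _ /=.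
  by rewrite linearZ /= liftU dE.
apply/eqP; rewrite -subr_eq0; apply/eqP/fgliftL_inj.
apply/eqP; rewrite linearB /= -fc' subr_eq0 fc; apply/eqP.
rewrite -[in RHS](freeg_sumE c) !linear_sum; apply: eq_bigr => a _ /=.
by rewrite linearZ /= liftU dE.
Qed.
End Bases.

Section Hopf.
Variable K : fieldType.
Local Notation QSym := (QSym K).
Local Notation M := (@M K).
Local Notation L := (@L K).

Definition MinOne_L (a : composition) : K^o :=
  if [pick k : 'I_(sumn a) | parts a == nseq k 1%N ++ [:: (sumn a - k)%N]]
  is Some k
  then (-1) ^+ k else 0.

Definition MinOne : {linear QSym -> K^o} := linext (@L_basis K) MinOne_L.

Lemma MinOneE a : MinOne (L a) = MinOne_L a.
Proof. exact: linextE. Qed.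

Lemma finite_deconcat (a : composition) : finite_set
  [set p : composition * composition | p.1 ++ p.2 = a :> seq nat].
Proof.
pose C n := [set b : composition | sumn b = n].
apply: (@sub_finite_set _ _ (\bigcup_(n in `I_(sumn a).+1)
                               (C n `*` C (sumn a - n)%N))).
  move=> [b c] /= bca; have sE : sumn a = (sumn b + sumn c)%N.
    by rewrite -bca sumn_cat.
  by exists (sumn b); rewrite /= ?ltnS sE ?leq_addr// /C /= addKn.
apply: bigcup_finite => // n _; apply: finite_setX; exact: finite_compositions.
Qed.

Definition coprod_M (a : composition) : tensor QSym QSym :=
  \sum_(p \in [set p : composition * composition | p.1 ++ p.2 = a :> seq nat])
    tens (M p.1) (M p.2).

Definition coprod : {linear QSym -> tensor QSym QSym} :=
  linext (@M_basis K) coprod_M.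

Lemma coprodE a : coprod (M a) = coprod_M a.
Proof. exact: linextE. Qed.

(* the counit *)
Definition const_coef (f : QSym) : K^o := f [fsfun].

Fact const_coef_linear : linear const_coef. Proof. by []. Qed.

HB.instance Definition _ :=
  GRing.isLinear.Build K QSym K^o *:%R const_coef const_coef_linear.

Fact homog_subproof d (f : QSym) :
  (fun m => if mdegree m == d then f m else 0) \in @quasisymmetric K.
Proof.
have /asboolP[_ fE] := qseriesP f; apply/asboolP; split.
  by exists d => m; rewrite ltnNge; case: eqP => // ->; rewrite leqnn.
by move=> m m' mm'; rewrite /mdegree mm' (fE _ _ mm').
Qed.

(* the projection onto the degree-d component *)
Definition homog d (f : QSym) : QSym := MkQSym (homog_subproof d f).

Fact homog_linear d : linear (homog d).
Proof.
move=> a f g; apply: QSymP => m; rewrite [RHS]QSymD [in RHS]QSymZ /=.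
by case: ifP => _; rewrite // mulr0 addr0.
Qed.

HB.instance Definition _ d :=
  GRing.isLinear.Build K QSym QSym *:%R (homog d) (homog_linear d).

(* The projection onto the tensor product of the components of degrees a_i is
   the tensor product of the projections, seen in the whole tensor power. *)
Definition coprod_comp (a : composition) : {linear QSym -> tpow QSym (size a)} :=
  tpow_map homog a \o iter_coprod coprod const_coef (size a).

End Hopf.

(* Main.v *)
(* By linearity it suffices to show that MinOne^(x)l o Delta_a takes the value
   [b = a] on psi_b. On the monomial basis MinOne is given by
   MinOne(M_b) = (-1)^(l(b) - 1) b_l, and Delta is deconcatenation, so this
   functional is a convolution product on compositions. Summation against the
   weights 1 / pi(b, c) over the coarsenings c of b is multiplicative for
   convolution, because the weights are products over blocks; so everything
   reduces to MinOne(psi_b) = [l(b) = 1]. Reading b from left to right and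
   deciding whether each part joins the current block or starts a new one, this
   follows from x / x - y / y = 0 by induction. *)
Require Import Defs.
From mathcomp Require Import all_boot all_order all_algebra.
From mathcomp Require Import finmap freeg complex.
From mathcomp Require Import all_classical reals.

Import GRing.Theory.

Local Open Scope classical_set_scope.
Local Open Scope ring_scope.

(** * Merging and splitting parts of a composition *)

Lemma refines_merge n x s c : refines (n + x :: s)%N c -> refines (n :: x :: s) c.
Proof.
case=> ss [ssE <-]; elim: ss s ssE => [|[|y u] ss IHss] s //= ssE.
  by have [tt [tE t']] := IHss _ ssE; exists ([::] :: tt); rewrite /= tE t'.
case: ssE => -> <-; exists ((n :: x :: u) :: ss).
by rewrite /= addnA.
Qed.

Lemma refines_cons n a b : refines a b -> refines (n :: a) (n :: b).
Proof. by case=> ss [<- <-]; exists ([:: n] :: ss); rewrite /= addn0. Qed.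

Lemma refines_head n s x c :
  (0 < x)%N -> refines (n :: s) (x :: c) -> (n <= x)%N.
Proof.
move=> x0 [[|[|y u] ss] [//= ssE [xE _]]]; first by rewrite -xE in x0.
by case: ssE => <- _; rewrite -xE leq_addr.
Qed.

Lemma refines_consP b x a : refines b (x :: a) <->
  exists s b', [/\ b = s ++ b', sumn s = x & refines b' a].
Proof.
split=> [[[|s ss] [//= <- [<- <-]]]|[s [b' [-> <- [ss [<- <-]]]]]].
  by exists s, (flatten ss); split=> //; exists ss.
by exists (s :: ss).
Qed.

(** * Weighted sums over coarsenings, and convolution *)

Section Coarsenings.
Variable K : fieldType.
Implicit Types F G H : seq nat -> K.

(* The sum of F c / pi(n :: s, c) over the coarsenings c of n :: s, except that
   the factor 1 / n of the first part is left out: n is the sum of the parts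
   already merged into the current block. *)
Fixpoint block_sum (n : nat) (s : seq nat) F : K :=
  if s is x :: s' then
    (n + x)%:R^-1 * block_sum (n + x) s' F
      + x%:R^-1 * block_sum x s' (fun c => F (n :: c))
  else F [:: n].

(** The weighting that defines [psi], as [coarsening_sum_coef] confirms: [x%:R^-1] restores the
    factor that [block_sum] leaves out. *)
Definition coarsening_sum s F : K :=
  if s is x :: s' then x%:R^-1 * block_sum x s' F else F [::].

(** The product dual to deconcatenation; empty prefixes and suffixes are included. *)
Definition conv F G (s : seq nat) : K :=
  \sum_(i < (size s).+1) F (take i s) * G (drop i s).

(** The recursion evaluates [F] only at coarsenings of [n :: s], reached by merging the next part or
    by closing the current block. *)
Lemma eq_block_sum n s F G : all (ltn 0) (n :: s) ->
  (forall c, all (ltn 0) c -> refines (n :: s) c -> F c = G c) ->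
  block_sum n s F = block_sum n s G.
Proof.
elim: s n F G => [|x s IHs] n F G /= /andP[n0 s0] FG.
  by apply: FG; [rewrite /= n0|exact: refines_refl].
congr (_ * _ + _ * _); apply: IHs => //=.
- by rewrite addn_gt0 n0; case/andP: s0.
- by move=> c c0 /refines_merge; exact: FG.
- by move=> c c0 sc; apply: FG; [rewrite /= n0|exact: refines_cons].
Qed.

Lemma block_sumD n s F G :
  block_sum n s (fun c => F c + G c) = block_sum n s F + block_sum n s G.
Proof.
by elim: s n F G => //= x s IHs n F G; rewrite !IHs !mulrDr addrACA.
Qed.

Lemma block_sumZ n s k F : block_sum n s (fun c => k * F c) = k * block_sum n s F.
Proof.
elim: s n F => //= x s IHs n F.
by rewrite !IHs mulrDr !(mulrCA k).
Qed.

Lemma block_sum0 n s F : (forall c, F c = 0) -> block_sum n s F = 0.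
Proof.
by elim: s n F => [|x s IHs] n F F0 //=; rewrite !IHs // !mulr0 addr0.
Qed.

Lemma block_sum_sum n s (I : Type) (r : seq I) (F : I -> seq nat -> K) :
  block_sum n s (fun c => \sum_(i <- r) F i c) = \sum_(i <- r) block_sum n s (F i).
Proof.
elim: r => [|i r IHr]; first by rewrite big_nil block_sum0// => c; rewrite big_nil.
rewrite big_cons -IHr -block_sumD; congr block_sum.
by apply/funext => c; rewrite big_cons.
Qed.

Lemma conv_cons F G n s :
  conv F G (n :: s) = F [::] * G (n :: s) + conv (fun c => F (n :: c)) G s.
Proof. by rewrite /conv big_ord_recl. Qed.

(** A cut of a coarsening lies before its first block, which gives the [F [::]] term, or at the end
    of some block. In the latter case it also cuts [s]: the prefix continues the open block and the
    suffix is coarsened afresh. *)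
Lemma block_sum_conv n s F G : block_sum n s (conv F G) =
  F [::] * block_sum n s G + conv (fun t => block_sum n t F) (coarsening_sum^~ G) s.
Proof.
elim: s n F => [|x s IHs] n F.
  by rewrite /= /conv big_ord_recl /= !big_ord_recl !big_ord0 /= !addr0.
rewrite /= conv_cons /= IHs.
under [fun c => conv F G _]eq_fun do rewrite conv_cons.
rewrite block_sumD block_sumZ IHs.
have -> : conv (fun c => block_sum n (x :: c) F) (coarsening_sum^~ G) s =
  (n + x)%:R^-1 * conv (fun t => block_sum (n + x) t F) (coarsening_sum^~ G) s +
  x%:R^-1 * conv (fun t => block_sum x t (fun c => F (n :: c))) (coarsening_sum^~ G) s.
  rewrite /conv !mulr_sumr -big_split; apply: eq_bigr => i _ /=.
  by rewrite mulrDl !mulrA.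
rewrite !mulrDr -!addrA; congr (_ + _); first by rewrite mulrCA.
rewrite ![x%:R^-1 * (F _ * _)]mulrCA.
rewrite [LHS]addrCA; congr (_ + _); rewrite addrCA; congr (_ + _).
Qed.

Lemma coarsening_sum_conv F G :
  coarsening_sum^~ (conv F G) =1 conv (coarsening_sum^~ F) (coarsening_sum^~ G).
Proof.
case=> [|x s] /=; first by rewrite /conv !big_ord_recl !big_ord0.
rewrite block_sum_conv conv_cons mulrDr mulrCA; congr (_ + _).
by rewrite /conv mulr_sumr; apply: eq_bigr => i _; rewrite mulrA.
Qed.

Lemma eq_coarsening_sum s F G : all (ltn 0) s ->
  (forall c, all (ltn 0) c -> refines s c -> F c = G c) ->
  coarsening_sum s F = coarsening_sum s G.
Proof.
case: s => [|x s] s0 FG /=; first by apply: FG => //; exact: refines_refl.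
by congr (_ * _); apply: eq_block_sum.
Qed.

Lemma coarsening_sum_sum s (I : Type) (r : seq I) (F : I -> seq nat -> K) :
  coarsening_sum s (fun c => \sum_(i <- r) F i c) =
  \sum_(i <- r) coarsening_sum s (F i).
Proof. by case: s => //= x s; rewrite block_sum_sum mulr_sumr. Qed.

Lemma coarsening_sumZ s k F :
  coarsening_sum s (fun c => k * F c) = k * coarsening_sum s F.
Proof. by case: s => //= x s; rewrite block_sumZ mulrCA. Qed.

Lemma coarsening_sum0 s F : all (ltn 0) s ->
  (forall c, all (ltn 0) c -> refines s c -> F c = 0) -> coarsening_sum s F = 0.
Proof.
move=> s0 F0; rewrite (@eq_coarsening_sum _ _ (fun=> 0))//.
by case: s {s0 F0} => //= x s; rewrite block_sum0 ?mulr0.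
Qed.

(** Only one sequence of decisions reaches the target: a new block opened inside [t] leaves the
    first part too small, and joining a part of [flatten ss] makes it too large. The product
    collects the running totals, without the factor [n]. *)
Lemma block_sum_delta n t ss : all (ltn 0) (n :: t) ->
  all (fun s => (0 < size s)%N && all (ltn 0) s) ss ->
  block_sum n (t ++ flatten ss)
    (fun c => (c == (n + sumn t)%N :: map sumn ss)%:R) =
  (\prod_(i < size t) (n + sumn (take i.+1 t))%N)%:R^-1 *
  coarsening_sum (flatten ss) (fun c => (c == map sumn ss)%:R).
Proof.
move=> /= /andP[n0 t0] ss0; elim: t n n0 t0 => [|z t IHt] n n0 /=.
  move=> _; rewrite big_ord0 invr1 mul1r addn0.
  case: ss ss0 => [|[|y u] ss] //=; first by rewrite eqxx.
  move=> /andP[/andP[y0 u0] ss0].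
  have yus0 : all (ltn 0) (u ++ flatten ss).
    rewrite all_cat u0; apply/allP => v /flattenP[w /(allP ss0)/andP[_ w0]].
    exact: (allP w0).
  rewrite (@eq_block_sum (n + y) _ _ (fun=> 0)) /=; last 2 first.
  - by rewrite addn_gt0 n0.
  - move=> c _; case: eqP => // -> /refines_head -/(_ n0).
    by rewrite leqNgt -[X in (X < _)%N]addn0 ltn_add2l y0.
  rewrite block_sum0// mulr0 add0r; congr (_ * block_sum _ _ _).
  by apply/funext => c; rewrite eqseq_cons eqxx.
move=> /andP[z0 t0]; rewrite addnA IHt ?addn_gt0 ?n0//.
rewrite (@block_sum0 z) ?mulr0 ?addr0; last first.
  move=> c; rewrite eqseq_cons -[X in X == _]addn0 -addnA eqn_add2l.
  by rewrite ltn_eqF// addn_gt0 z0.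
rewrite mulrA big_ord_recl /= take0 /= addn0 natrM invfM; congr (_ / _%:R * _).
by apply: eq_bigr => i _; rewrite addnA.
Qed.

Lemma coarsening_sum_delta ss :
  all (fun s => (0 < size s)%N && all (ltn 0) s) ss ->
  coarsening_sum (flatten ss) (fun c => (c == map sumn ss)%:R) =
  (\prod_(s <- ss) pi_comp s)%:R^-1.
Proof.
elim: ss => [|[|x t] ss IHss] //=; first by rewrite big_nil invr1.
move=> /andP[/andP[x0 t0] ss0]; rewrite block_sum_delta//= ?x0// IHss//.
rewrite mulrA big_cons /pi_comp big_ord_recl /= take0 /= addn0.
by rewrite !natrM !invfM.
Qed.

End Coarsenings.

(** * The recursive sums compute the weights in [psi] *)

Lemma sumn_take_cat s a j : (size s <= j)%N ->
  sumn (take j (s ++ a)) = (sumn s + sumn (take (j - size s) a))%N.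
Proof. by move=> sj; rewrite take_cat ltnNge sj /= sumn_cat. Qed.

Lemma leq_sumn_take j s : (sumn (take j s) <= sumn s)%N.
Proof. by rewrite -{2}(cat_take_drop j s) sumn_cat leq_addr. Qed.

Lemma sumn_take_gt0 s j : (j < size s)%N -> all (ltn 0) s ->
  (0 < sumn (take j.+1 s))%N.
Proof. by case: s => //= x s _ /andP[x0 _]; rewrite addn_gt0 x0. Qed.

(** Since parts are positive, partial sums increase strictly, so the interval test in [block]
    selects exactly the positions of the [i]-th list. *)
Lemma block_flatten ss i :
  all (fun s => (0 < size s)%N && all (ltn 0) s) ss -> (i < size ss)%N ->
  block (flatten ss) (map sumn ss) i = nth [::] ss i.
Proof.
elim: ss i => [//|s ss IHss] i /= /andP[/andP[sn s0] ss0] iss.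
have f0 : all (ltn 0) (flatten ss).
  apply/allP => v /flattenP[w /(allP ss0)/andP[_ w0]].
  exact: (allP w0).
rewrite /block size_cat iotaD add0n filter_cat map_cat -[X in iota X (size (flatten ss))]addn0 iotaDl.
rewrite filter_map -map_comp.
case: i iss => [_|i iss] /=.
  rewrite take0 /= addn0 [X in _ ++ X](_ : _ = [::]) ?cats0; last first.
    apply/eqP; rewrite -size_eq0 size_map size_filter -leqn0 leqNgt -has_count.
    apply/hasPn => j; rewrite mem_iota /= => jlt.
    rewrite negb_and -leqNgt -ltnNge; apply/orP; right.
    rewrite sumn_take_cat; last by rewrite -addnS leq_addr.
    by rewrite -addnS addKn -[X in (X < _)%N]addn0 ltn_add2l sumn_take_gt0.
  rewrite (@eq_in_filter _ _ predT) ?filter_predT; last first.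
    move=> j; rewrite mem_iota /= add0n => jlt.
    rewrite take_cat; have [jlt'|] := ltnP j.+1 (size s).
      by rewrite sumn_take_gt0// leq_sumn_take.
    move=> sj; have -> : j.+1 = size s by apply/eqP; rewrite eqn_leq jlt.
    rewrite subnn take0 cats0 leqnn andbT.
    by case: (s) sn s0 => //= x u _ /andP[x0 _]; rewrite addn_gt0 x0.
  apply: (@eq_from_nth _ 0%N); rewrite size_map size_iota// => j jlt.
  by rewrite (nth_map 0%N) ?size_iota// nth_iota// add0n nth_cat jlt.
rewrite [X in X ++ _](_ : _ = [::]) /=; last first.
  apply/eqP; rewrite -size_eq0 size_map size_filter -leqn0 leqNgt -has_count.
  apply/hasPn => j; rewrite mem_iota add0n /= => jlt.
  rewrite negb_and -leqNgt; apply/orP; left.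
  apply: (leq_trans _ (leq_addr _ _)).
  rewrite takel_cat//; exact: leq_sumn_take.
rewrite -IHss// /block; set p := seq.filter _ _; set q := seq.filter _ _.
(* Past the first block every partial sum contains [sumn s], so both bounds shift by the same
   amount. *)
have -> : p = q.
  apply: eq_in_filter => j _ /=.
  rewrite sumn_take_cat; last by rewrite -addnS leq_addr.
  by rewrite -(addnS (size s)) addKn ltn_add2l leq_add2l.
by apply: eq_map => j /=; rewrite nth_cat ltnNge leq_addr /= addKn.
Qed.

Lemma pi_refine_flatten ss :
  all (fun s => (0 < size s)%N && all (ltn 0) s) ss ->
  pi_refine (flatten ss) (map sumn ss) = (\prod_(s <- ss) pi_comp s)%N.
Proof.
move=> ss0; rewrite /pi_refine size_map (big_nth [::]) big_mkord.
by apply: eq_bigr => i _; rewrite block_flatten.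
Qed.

(** The witness [ss] of the refinement lists the blocks; they are nonempty because the parts of [b]
    are positive, and both sides become the inverse of a product of [pi_comp]. *)
Lemma coarsening_sum_coef (K : fieldType) (a b : composition) :
  coarsening_sum K a (fun c => (c == b)%:R) =
  if `[< refines a b >] then (pi_refine a b)%:R^-1 else 0.
Proof.
case: asboolP => [[ss [aE bE]]|ab].
  have ss0 : all (fun s => (0 < size s)%N && all (ltn 0) s) ss.
    apply/allP => s sss; apply/andP; split.
      have : sumn s \in parts b by rewrite -bE map_f.
      by move=> /(allP (parts_gt0 b)) /=; case: s sss.
    apply/allP => x xs; apply: (allP (parts_gt0 a)).
    by rewrite -aE; apply/flattenP; exists s.
  by rewrite -aE -bE pi_refine_flatten// coarsening_sum_delta.
apply: coarsening_sum0; first exact: parts_gt0.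
by move=> c _ ac; case: eqP => // cb; rewrite cb in ac.
Qed.

Lemma linear_psi (K : fieldType) (T : {linear QSym K -> K^o}) (g : seq nat -> K) :
  (forall b : composition, T (M K b) = g b) ->
  forall a : composition, T (psi K a) = coarsening_sum K a g.
Proof.
move=> TM a; rewrite /psi fsbig_finite; last exact: finite_coarsening.
set r := fset_set _; rewrite linear_sum.
have rP b : (b \in r) = `[< refines a b >].
  by rewrite in_fset_set; [exact: asbool_equiv_eq|exact: finite_coarsening].
(* On coarsenings of [a], [g] is a combination of indicators, and the sum of each indicator is a
   coefficient of [psi]. *)
rewrite (@eq_coarsening_sum _ _ _ (fun c => \sum_(b <- r) g b * (c == b)%:R)).
- rewrite coarsening_sum_sum; apply: eq_big_seq => b; rewrite rP => ab.
  by rewrite coarsening_sumZ coarsening_sum_coef ab linearZ /= TM mulrC.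
- exact: parts_gt0.
- move=> c c0 ac; pose b := Composition c0.
  have br : b \in r by rewrite rP; exact/asboolP.
  rewrite (big_fsetD1 b)//= eqxx mulr1 big1_fset ?addr0// => d.
  rewrite !inE => /andP[db _] _; case: eqP => [cd|]; rewrite ?mulr0//.
  by rewrite -val_eqE /= cd eqxx in db.
Qed.

(** * [MinOne] on the monomial basis *)

Section MinOneMonomial.
Variable K : fieldType.

(* The value of MinOne on a monomial quasisymmetric function. *)
Definition signed_last (s : seq nat) : K :=
  if s is x :: t then (-1) ^+ size t * (last x t)%:R else 0.

Lemma signed_last_cons x s : s != [::] -> signed_last (x :: s) = - signed_last s.
Proof. by case: s => //= y s _; rewrite exprS -mulrA mulN1r. Qed.

Definition bump_head (s : seq nat) : seq nat :=
  if s is x :: t then x.+1 :: t else [::].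

(** Raising the first part affects the last part only when they coincide. *)
Lemma signed_last_bump s : s != [::] ->
  signed_last (bump_head s) = signed_last s + (size s == 1)%:R.
Proof.
case: s => [|x [|y s]]//= _; last by rewrite addr0.
by rewrite expr0 !mul1r natr1.
Qed.

(* A refinement of x.+2 :: a either starts with 1 or has a first part that can
   be decreased; both cases give a refinement of x.+1 :: a. *)
Fixpoint refinements (a : seq nat) : seq (seq nat) :=
  if a is x :: a' then
    iter x.-1 (fun l => map (cons 1%N) l ++ map bump_head l)
      (map (cons 1%N) (refinements a'))
  else [:: [::]].

Lemma refinementsS2 x a : refinements (x.+2 :: a) =
  map (cons 1%N) (refinements (x.+1 :: a)) ++
  map bump_head (refinements (x.+1 :: a)).
Proof. by []. Qed.

Lemma nil_notin_refinements a : a != [::] -> [::] \notin refinements a.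
Proof.
case: a => // x a _ /=; elim: x.-1 => [|n IHn] /=; first by apply/mapP => -[].
rewrite mem_cat negb_or; apply/andP; split; first by apply/mapP => -[].
by apply/mapP => -[[|y s]]// sl; rewrite sl in IHn.
Qed.

Lemma refinements_neq_nil a s : a != [::] -> s \in refinements a -> s != [::].
Proof. by move=> /nil_notin_refinements /[swap] sa; apply: contraNneq => <-. Qed.

Lemma refines_nil b : refines b [::] <-> b = [::].
Proof. by split=> [[ss [<-]]|->]; [case: ss|exact: refines_refl]. Qed.

Lemma refines1P b a : all (ltn 0) b ->
  refines b (1%N :: a) <-> exists2 b', b = 1%N :: b' & refines b' a.
Proof.
move=> b0; split=> [/refines_consP[s [b' [bE s1 b'a]]]|[b' -> b'a]]; last first.
  exact: refines_cons.
exists b' => //; move: b0; rewrite bE all_cat => /andP[+ _].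
case: s s1 {bE} => [//|[//|[|x]]//= [|y s]]//= [].
by move=> ys /andP[y0 _]; move: ys y0; case: y.
Qed.

Lemma refines2P b x a : all (ltn 0) b ->
  refines b (x.+2 :: a) <->
  (exists2 b', b = 1%N :: b' & refines b' (x.+1 :: a)) \/
  (exists y b', b = y.+2 :: b' /\ refines (y.+1 :: b') (x.+1 :: a)).
Proof.
move=> b0; split=> [/refines_consP[s [b' [bE sx b'a]]]|].
  move: b0; rewrite bE all_cat => /andP[+ _].
  case: s sx {bE} => [//|[//|[|y]] s]//= sx s0.
    by left; exists (s ++ b') => //; apply/refines_consP; exists s, b'; case: sx.
  right; exists y, (s ++ b'); split=> //.
  by apply/refines_consP; exists (y.+1 :: s), b'; case: sx => <-.
case=> [[b' -> /refines_consP[s [c [-> sx ca]]]]|].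
  by apply/refines_consP; exists (1%N :: s), c; rewrite /= sx.
move=> [y [b' [-> /refines_consP[[|z s] [c [//= [<- ->] sx ca]]]]]].
by apply/refines_consP; exists (y.+2 :: s), c; rewrite /= -sx.
Qed.

Lemma refinementsP a b : all (ltn 0) a ->
  b \in refinements a <-> all (ltn 0) b /\ refines b a.
Proof.
elim: a b => [|x a IHa] b.
  by rewrite inE; split=> [/eqP->|[_ /refines_nil->]]//; split=> //; exact/refines_nil.
case: x => // x /= a0; elim: x b => [|x IHx] b.
  split=> [/mapP[c /IHa [//|c0 ca ->]]|[b0 /(refines1P b a b0)[c bE ca]]].
    by split=> //; exact: refines_cons.
  by rewrite bE map_f// (IHa _ a0); split=> //; move: b0; rewrite bE.
rewrite /= mem_cat; split.
  case/orP => /mapP[c cl ->]; have [c0 ca] := (IHx c).1 cl.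
    by split=> //; apply/refines2P => //; left; exists c.
  case: c c0 ca {cl} => [|[|y] c]//= c0 ca; first by have := refines_sumn ca.
  by split=> //; apply/refines2P => //; right; exists y, c.
move=> [b0 /(refines2P b x a b0)[[c bE ca]|[y [c [bE ca]]]]]; apply/orP.
  by left; rewrite bE map_f// IHx; split=> //; move: b0; rewrite bE.
right; apply/mapP; exists (y.+1 :: c); rewrite ?bE// IHx; split=> //.
by move: b0; rewrite bE.
Qed.

(** The two halves of the enumeration are disjoint: one consists of lists starting with 1, the other
    of lists starting with at least 2. *)
Lemma refinements_uniq a : all (ltn 0) a -> uniq (refinements a).
Proof.
elim: a => // x a IHa /= /andP[x0 a0].
case: x x0 => // x _ /=; elim: x => [|x IHx] /=.
  by rewrite map_inj_uniq ?IHa// => s t [].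
have xa0 : all (ltn 0) (x.+1 :: a) by [].
rewrite cat_uniq map_inj_uniq ?IHx; last by move=> s t [].
rewrite map_inj_in_uniq ?IHx ?andbT /=; last first.
  move=> s t /(@refinements_neq_nil (x.+1 :: a) _ isT).
  move=> + /(@refinements_neq_nil (x.+1 :: a) _ isT).
  by case: s => // y s; case: t => // z t _ _ /= [-> ->].
apply/hasPn => _ /mapP[s sl ->]; apply/mapP => -[t _].
have [+ _] := (refinementsP (x.+1 :: a) s xa0).1 sl.
by case: s sl => // -[|y] s _ //= _ [].
Qed.

Lemma sum_refinements_size1 x a :
  \sum_(s <- refinements (x.+1 :: a)) (size s == 1)%:R = (a == [::])%:R :> K.
Proof.
elim: x => [|x IHx].
  rewrite /= big_map; case: a => [|y a]; first by rewrite big_seq1.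
  rewrite big_seq big1// => s /(refinements_neq_nil (y :: a) s isT).
  by case: s.
rewrite refinementsS2 big_cat !big_map -IHx.
have := @refinements_neq_nil (x.+1 :: a); move: (refinements _) => l l0 /=.
rewrite [X in X + _]big_seq [X in X + _]big1 ?add0r => [|s /(l0 _ isT)].
  by apply: eq_bigr => -[|y s].
by case: s.
Qed.

(** [MinOne_L] by structural recursion. The empty list gets 0, as no [k] satisfies [k < 0]. *)
Fixpoint hook_sign (a : seq nat) : K :=
  if a is x :: a' then
    if a' is _ :: _ then if x == 1%N then - hook_sign a' else 0 else 1
  else 0.

(** For a first part 1, prefixing 1 flips the sign. For a larger one, [1 :: s] and [bump_head s]
    cancel unless [s] has a single part, where 1 is left over. *)
Lemma sum_refinements a : all (ltn 0) a ->
  \sum_(s <- refinements a) signed_last s = hook_sign a.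
Proof.
elim: a => [|[|x] a IHa]//=; first by rewrite big_seq1.
move=> a0; case: x => [|x].
  rewrite /= big_map; case: a a0 IHa => [|y a] a0 IHa.
    by rewrite /= big_seq1 /= expr0 mul1r.
  rewrite -IHa// -sumrN; apply: eq_big_seq => s sa.
  exact/signed_last_cons/(refinements_neq_nil (y :: a) s isT).
rewrite -[iter _ _ _]/(refinements (x.+2 :: a)) refinementsS2.
rewrite big_cat !big_map; set l := refinements _; rewrite /= -big_split /=.
rewrite (eq_big_seq (fun s => (size s == 1)%:R)) => [|s sa].
  by rewrite sum_refinements_size1; case: (a).
have s0 := refinements_neq_nil (x.+1 :: a) s isT sa.
rewrite -[X in X + _]/(signed_last (1%N :: s)) signed_last_cons//.
by rewrite signed_last_bump// addrA addNr add0r.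
Qed.

Lemma hook_sign_nseq k m : hook_sign (nseq k 1%N ++ [:: m]) = (-1) ^+ k.
Proof.
elim: k => // k IHk; rewrite exprS mulN1r -IHk /=.
by case: k {IHk}.
Qed.

Lemma hook_sign_eq0 a :
  (forall k m, a <> nseq k 1%N ++ [:: m]) -> hook_sign a = 0.
Proof.
elim: a => //= x [|y a] IHa ha; first by have := ha 0%N x.
case: eqP => // x1; rewrite IHa ?oppr0// => k m yE.
by apply: (ha k.+1 m); rewrite x1 /= yE.
Qed.

Lemma MinOne_L_hook (a : composition) : MinOne_L K a = hook_sign a.
Proof.
rewrite /MinOne_L; case: pickP => [k /eqP aE|none].
  by rewrite -(hook_sign_nseq k (sumn a - k)) -aE.
rewrite hook_sign_eq0// => k m aE.
(* Positivity of the last part gives [k < sumn a], so [k] is an index that [pick] examines. *)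
have m0 : (0 < m)%N.
  by apply: (allP (parts_gt0 a)); rewrite aE mem_cat mem_head orbT.
have sE : sumn a = (k + m)%N by rewrite aE sumn_cat sumn_nseq mul1n /= addn0.
have kl : (k < sumn a)%N by rewrite sE -[X in (X < _)%N]addn0 ltn_add2l.
by have := none (Ordinal kl); rewrite /= sE addKn aE eqxx.
Qed.

Lemma eq_linear_basis (I : choiceType) (V W : lmodType K) (b : I -> V)
    (T U : {linear V -> W}) :
  is_basis b -> (forall i, T (b i) = U (b i)) -> T =1 U.
Proof.
move=> hb TU v; rewrite -(coordsK hb v) -(freeg_sumE (coords hb v)) !linear_sum.
by apply: eq_bigr => i _ /=; rewrite liftU !linearZ TU.
Qed.

Lemma MinOne_M (b : composition) : MinOne K (M K b) = signed_last b.
Proof.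
(* [T] has the claimed values on the [M] basis; agreement with [MinOne] on the [L] basis then forces
   equality. *)
pose T := linext (@M_basis K) (fun b : composition => signed_last b : K^o).
have TL a : T (L K a) = MinOne K (L K a).
  rewrite MinOneE MinOne_L_hook -sum_refinements; last exact: parts_gt0.
  rewrite /L fsbig_finite; last exact: finite_refining.
  rewrite linear_sum; under eq_bigr do rewrite linextE.
  rewrite -(big_map (@parts : composition -> seq nat) predT signed_last).
  apply: perm_big; apply: uniq_perm.
  - by rewrite map_inj_uniq ?fset_uniq//; exact: val_inj.
  - exact/refinements_uniq/parts_gt0.
  move=> s; apply/mapP/idP => [[c]|].
    rewrite in_fset_set ?inE; last exact: finite_refining.
    move=> ca ->; apply/refinementsP; first exact: parts_gt0.
    by split=> //; exact: parts_gt0.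
  move=> /(refinementsP a s (parts_gt0 a))[s0 sa].
  exists (Composition s0) => //.
  by rewrite in_fset_set ?inE//; exact: finite_refining.
by rewrite -(eq_linear_basis _ _ _ _ _ _ (@L_basis K) TL) linextE.
Qed.

End MinOneMonomial.

(** * Iterated coproducts as iterated convolutions *)

Section Coproduct.
Variable K : fieldType.

Lemma conv_nill (G : seq nat -> K) s : conv K (fun c => (c == [::])%:R) G s = G s.
Proof.
rewrite /conv big_ord_recl take0 drop0 eqxx mul1r big1 ?addr0// => i _.
by case: s i => [[]|x s i] //; rewrite /= mul0r.
Qed.

Lemma conv_nilr (F : seq nat -> K) s : conv K F (fun c => (c == [::])%:R) s = F s.
Proof.
rewrite /conv big_ord_recr /= take_size drop_size eqxx mulr1 big1 ?add0r// => i _.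
by rewrite -size_eq0 size_drop subn_eq0 leqNgt ltn_ord mulr0.
Qed.

Lemma linear_coprod_M (T : {linear tensor (QSym K) (QSym K) -> K^o})
    (g h : seq nat -> K) :
  (forall b c : composition, T (tens (M K b) (M K c)) = g b * h c) ->
  forall a : composition, T (coprod K (M K a)) = conv K g h a.
Proof.
move=> Tgh a; rewrite coprodE /coprod_M fsbig_finite; last exact: finite_deconcat.
set r := fset_set _; rewrite linear_sum; under eq_bigr do rewrite Tgh.
pose pp (p : composition * composition) := (parts p.1, parts p.2).
(* Over pairs of plain lists, deconcatenations and cut positions give two duplicate-free
   enumerations of the same pairs. *)
rewrite -(big_map pp predT (fun p => g p.1 * h p.2)).
rewrite /conv -(big_mkord predT (fun i => g (take i a) * h (drop i a))).
rewrite -(big_map (fun i => (take i a, drop i a)) predT (fun p => g p.1 * h p.2)).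
apply: perm_big; apply: uniq_perm.
- rewrite map_inj_uniq ?fset_uniq// => -[b c] [b' c'] [bb' cc'].
  by congr pair; exact: val_inj.
- rewrite map_inj_in_uniq ?iota_uniq// => i j.
  rewrite !mem_index_iota !ltnS /= => ia ja [/(congr1 size) + _].
  by rewrite !size_takel.
move=> [s t]; apply/mapP/mapP => [[[b c]]|[i _ [-> ->]]].
  rewrite in_fset_set ?inE /=; last exact: finite_deconcat.
  move=> bca [-> ->]; exists (size b).
    by rewrite mem_index_iota ltnS -bca size_cat leq_addr.
  by rewrite -bca take_size_cat// drop_size_cat.
have /andP[t0 d0] : all (ltn 0) (take i a) && all (ltn 0) (drop i a).
  by rewrite -all_cat cat_take_drop parts_gt0.
exists (Composition t0, Composition d0) => //.
by rewrite in_fset_set ?inE /= ?cat_take_drop//; exact: finite_deconcat.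
Qed.

Definition graded_signed_last d (s : seq nat) : K :=
  if sumn s == d then signed_last K s else 0.

Lemma MinOne_homog_M d (b : composition) :
  MinOne K (homog d (M K b)) = graded_signed_last d b.
Proof.
rewrite /graded_signed_last -MinOne_M.
have -> : homog d (M K b) = if sumn b == d then M K b else 0.
  apply: QSymP => m; rewrite (fun_if (fun g : QSym K => g m)) /= /mdegree.
  by case: (exponents m =P b) => [->|_]; do ?case: ifP.
by case: ifP => // _; rewrite linear0.
Qed.

(* The value of MinOne^(x)l o Delta_a on a monomial quasisymmetric function. *)
Fixpoint conv_signed_last (a : seq nat) : seq nat -> K :=
  if a is x :: a' then conv K (graded_signed_last x) (conv_signed_last a')
  else fun s => (s == [::])%:R.

Lemma const_coef_M (b : composition) : const_coef (M K b) = (parts b == [::])%:R.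
Proof.
by rewrite /const_coef /= /exponents finsupp0 /= eq_sym.
Qed.

Lemma tensor_fun_map_tens (U1 U2 U3 W1 W2 W3 : lmodType K)
    (p : {linear U3 -> K^o}) (q : {linear W3 -> K^o})
    (g' : {linear U2 -> U3}) (h' : {linear W2 -> W3})
    (g : {linear U1 -> U2}) (h : {linear W1 -> W2}) u w :
  tensor_fun p q (tensor_map g' h' (tensor_map g h (tens u w))) =
  p (g' (g u)) * q (h' (h w)).
Proof. by rewrite !tensor_map_tens tensor_fun_tens. Qed.

Lemma tpow_fun_coprod_M (s : seq nat) (b : composition) :
  tpow_fun (MinOne K) (size s)
    (tpow_map (@homog K) s (iter_coprod (coprod K) (@const_coef K) (size s) (M K b)))
  = conv_signed_last s b.
Proof.
elim: s b => [|x [|y s] IHs] b; first exact: const_coef_M.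
  (* A single tensor factor involves no coproduct, whereas [conv_signed_last] still convolves with
     the unit. *)
  by rewrite [RHS]conv_nilr -MinOne_homog_M.
pose phi := tpow_fun (MinOne K) (size (y :: s)).
pose h := tpow_map (@homog K) (y :: s).
pose D := iter_coprod (coprod K) (@const_coef K) (size (y :: s)).
(* Everything applied after the outermost coproduct; it factors on pure tensors. *)
pose T : {linear tensor (QSym K) (QSym K) -> K^o} :=
  tensor_fun (MinOne K) phi \o (tensor_map (@homog K x) h \o tensor_map idfun D).
rewrite -[LHS]/(T (coprod K (M K b))); apply: linear_coprod_M => c d.
rewrite [LHS](tensor_fun_map_tens _ _ _ _ _ _ (MinOne K) phi (@homog K x) h idfun D).
by rewrite MinOne_homog_M; congr (_ * _); exact: IHs.
Qed.

End Coproduct.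

(** * Duality with [psi] in characteristic zero *)

Section Duality.
Variable K : fieldType.
Hypothesis charK : [pchar K] =i pred0.

(** With one part left, joining gives [(n + x) / (n + x)] and starting a block gives [- x / x]. With
    more parts, each branch vanishes by induction, the second after the closed block [n] contributes
    a sign. *)
Lemma block_sum_signed_last n x s : all (ltn 0) [:: n, x & s] ->
  block_sum K n (x :: s) (signed_last K) = 0.
Proof.
have natK m : (0 < m)%N -> m%:R != 0 :> K.
  by rewrite (GRing.pcharf0P K).1// -lt0n.
elim: s n x => [|y s IHs] n x /= /and3P[n0 x0 s0].
  rewrite /= expr0 expr1 mul1r mulN1r mulrN !mulVf ?subrr//; apply: natK => //.
  by rewrite addn_gt0 n0.
rewrite -[LHS]/((n + x)%:R^-1 * block_sum K (n + x) (y :: s) (signed_last K) +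
  x%:R^-1 * block_sum K x (y :: s) (fun c => signed_last K (n :: c))).
rewrite IHs; last by rewrite /= addn_gt0 n0.
rewrite (@eq_block_sum _ _ _ _ (fun c => -1 * signed_last K c)); last 2 first.
- by rewrite /= x0.
- move=> c _ rc; rewrite signed_last_cons ?mulN1r//.
  by apply/eqP => c0; move: rc; rewrite c0 => /refines_nil.
by rewrite block_sumZ IHs /= ?x0// !mulr0 addr0.
Qed.

(** Coarsening preserves the total, so the degree condition factors out and the vanishing above
    leaves only one-part lists. *)
Lemma coarsening_sum_graded d s : all (ltn 0) s ->
  coarsening_sum K s (graded_signed_last K d) = (s == [:: d])%:R.
Proof.
move=> s0; rewrite (@eq_coarsening_sum _ _ _
  (fun c => (sumn s == d)%:R * signed_last K c))//; last first.
  move=> c _ /refines_sumn sc; rewrite /graded_signed_last -sc.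
  by case: ifP; rewrite ?mul1r ?mul0r.
rewrite coarsening_sumZ; case: s s0 => [|x [|y s]] s0; first by rewrite mulr0.
  rewrite /= addn0 expr0 mul1r mulVf ?mulr1 ?eqseq_cons ?andbT//.
  by rewrite (GRing.pcharf0P K).1// -lt0n; case/andP: s0.
rewrite -[coarsening_sum _ _ _]/(x%:R^-1 * block_sum K x (y :: s) _) block_sum_signed_last//.
by rewrite !mulr0 !eqseq_cons andbF.
Qed.

(** By multiplicativity this is a convolution of indicators: those of [[:: x]] and [a] convolve to
    that of [x :: a]. *)
Lemma coarsening_sum_conv_signed_last a s : all (ltn 0) s ->
  coarsening_sum K s (conv_signed_last K a) = (s == a)%:R.
Proof.
elim: a s => [|x a IHa] s s0 /=.
  by case: s s0 => [|y s] s0 //; apply: coarsening_sum0 => // -[|//] _ /refines_nil.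
rewrite coarsening_sum_conv.
have -> : conv K (coarsening_sum K ^~ (graded_signed_last K x))
    (coarsening_sum K ^~ (conv_signed_last K a)) s =
  conv K (fun c => (c == [:: x])%:R) (fun c => (c == a)%:R) s.
  apply: eq_bigr => i _; rewrite coarsening_sum_graded ?IHa//.
    by rewrite -(cat_take_drop i s) all_cat in s0; case/andP: s0.
  by rewrite -(cat_take_drop i s) all_cat in s0; case/andP: s0.
case: s {s0} => [|y s]; first by rewrite /conv big_ord_recl big_ord0 /= mul0r addr0.
(* The empty prefix differs from [[:: x]]. Once the head equals [x], what remains of the first
   indicator is that of the empty list, the unit of [conv]. *)
rewrite conv_cons mul0r add0r [in RHS]eqseq_cons.
case: (y =P x) => [->|yx].
  rewrite -[RHS](conv_nill _ (fun c => (c == a)%:R)).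
  by apply: eq_bigr => i _; rewrite eqseq_cons eqxx.
by rewrite /conv big1// => i _; rewrite eqseq_cons; case: eqP => //; rewrite mul0r.
Qed.

Lemma tpow_fun_coprod_psi (a b : composition) :
  tpow_fun (MinOne K) (size a) (coprod_comp K a (psi K b)) = (b == a)%:R.
Proof.
pose T : {linear QSym K -> K^o} := tpow_fun (MinOne K) (size a) \o coprod_comp K a.
rewrite -[LHS]/(T _) (linear_psi K T (conv_signed_last K a)).
  by rewrite coarsening_sum_conv_signed_last ?parts_gt0.
by move=> c; exact: tpow_fun_coprod_M.
Qed.

End Duality.

Theorem theorem3p5 (R : realType) (f : QSym R[i])
    (c : composition -> R[i]) :
  finite_set [set a | c a != 0] ->
  f = \sum_(a \in [set: composition]) c a *: psi R[i] a ->
  forall a : composition,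
    c a = tpow_fun (MinOne R[i]) (size a) (coprod_comp R[i] a f).
Proof.
move=> finc -> a.
pose T : {linear QSym R[i] -> R[i]^o} :=
  tpow_fun (MinOne R[i]) (size a) \o coprod_comp R[i] a.
(* The sum over all compositions is restricted to the finite support of [c]; if [a] lies outside it,
   both sides are 0. *)
rewrite -[RHS]/(T _) (@fsbigTE _ _ _ _ (fset_set [set a | c a != 0])) => [|b].
  rewrite linear_sum.
  have TE b : T (c b *: psi R[i] b) = c b * (b == a)%:R.
    by rewrite linearZ -tpow_fun_coprod_psi//; exact: Num.Theory.pchar_num.
  under eq_bigr do rewrite TE.
  set r := fset_set _; have [ar|] := boolP (a \in r).
    rewrite (big_fsetD1 a)//= eqxx mulr1 big1_fset ?addr0// => b.
    by rewrite !inE => /andP[/negbTE-> _] _; rewrite mulr0.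
  move=> ar; rewrite big1_fset => [|b br _].
    by move: ar; rewrite in_fset_set// notin_setE /= => /negP/negPn/eqP.
  by case: eqP => [ba|]; rewrite ?mulr0//; rewrite -ba br in ar.
by rewrite in_fset_set// notin_setE /= => /negP/negPn/eqP->; rewrite scale0r.
Qed.
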